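(* Let $D$ be a $k$-fold circuit in a matroid $\mathcal{M}=(E,r)$ with closure operator $\mathrm{cl}$, and let $\{A_1,\dots,A_\ell\}$ be the principal partition of $D$. Then \[ r\Big(\bigcap_{i=1}^\ell \mathrm{cl}(D\setminus A_i)\Big)\leq \ell-k. \] Moreover, equality holds if and only if, for every $2\leq n\leq \ell$, the flats $\bigcap_{i=1}^{n-1}\mathrm{cl}(D\setminus A_i)$ and $\mathrm{cl}(D\setminus A_n)$ form a modular pair of flats of $\mathcal{M}$.
   Context: Matroids have finite ground sets. A cyclic set of $\mathcal{M}=(E,r)$ is a set $D\subseteq E$ with $r(D-e)=r(D)$ for all $e\in D$ (equivalently a union of circuits). A $k$-fold circuit is a cyclic set $D$ with $r(D)=|D|-k$. The closure is $\mathrm{cl}(X)=\{x\in E: r(X+x)=r(X)\}$ and a flat is a set $F$ with $\mathrm{cl}(F)=F$. The principal partition of a $k$-fold circuit $D$ is the collection $\{D\setminus B: B\subseteq D \text{ is a } (k-1)\text{-fold circuit of } \mathcal{M}\}$ (it is a partition of $D$). Two flats $X,Y$ form a modular pair if $r(X)+r(Y)=r(\mathrm{cl}(X\cup Y))+r(X\cap Y)$. *)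

(* Defs.v *)
From HB Require Import structures.
From mathcomp Require Import all_boot all_order all_algebra.

Set Implicit Arguments.
Unset Strict Implicit.
Unset Printing Implicit Defensive.

(* The ground set of a matroid is the whole finite type E. *)
Record matroid (E : finType) := Matroid {
  rk :> {set E} -> nat;
  rk_le_card : forall X : {set E}, rk X <= #|X|;
  rk_mono : forall X Y : {set E}, X \subset Y -> rk X <= rk Y;
  rk_submod : forall X Y : {set E}, rk (X :|: Y) + rk (X :&: Y) <= rk X + rk Y
}.

Section MatroidDefs.

Variables (E : finType) (M : matroid E).
Implicit Types (D X Y : {set E}) (k : nat).

Definition cl X : {set E} := [set x | M (x |: X) == M X].

Definition flat X : bool := cl X == X.

Definition cyclic_set D : bool := [forall e in D, M (D :\ e) == M D].

(* r(D) = |D| - k, written additively because subtraction on nat is truncated. *)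
Definition fold_circuit k D : bool := cyclic_set D && (M D + k == #|D|).

(* Meaningful for k >= 1 only: for k = 0 the predecessor k.-1 is 0, not -1. *)
Definition principal_partition k D : {set {set E}} :=
  [set D :\: B | B : {set E} & (B \subset D) && fold_circuit k.-1 B].

Definition modular_pair X Y : bool :=
  [&& flat X, flat Y & M X + M Y == M (cl (X :|: Y)) + M (X :&: Y)].

End MatroidDefs.

(* Main.v *)
Require Import Defs.
From HB Require Import structures.
From mathcomp Require Import all_boot all_order all_algebra.
From mathcomp Require Import zify.

Set Implicit Arguments.
Unset Strict Implicit.
Unset Printing Implicit Defensive.

(** Put [F_i = cl (D \ A_i)] and [X_n = F_1 ∩ ... ∩ F_n].  Since the [A_i] are
    pairwise disjoint, [X_{n-1}] contains [A_n], so [X_{n-1} ∪ F_n] spans [D] and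
    submodularity gives [r X_n <= r X_{n-1} + r F_n - r D = r X_{n-1} - |A_n| + 1],
    with equality exactly when [X_{n-1}] and [F_n] form a modular pair.  Summing
    over [n] and using that the [A_i] cover [D] bounds [r X_l] by
    [r D - |D| + l = l - k]. *)

Section Closure.
Variables (E : finType) (M : matroid E).
Implicit Types (X Y : {set E}) (x : E).

Lemma sub_cl X : X \subset cl M X.
Proof. by apply/subsetP=> x xX; rewrite inE (setUidPr _) ?sub1set. Qed.

(** Submodularity for [x |: X] and [Y]: their union is [x |: Y] and their intersection contains
    [X]. *)
Lemma rk_setU1_eq X Y x : X \subset Y -> M (x |: X) = M X -> M (x |: Y) = M Y.
Proof.
move=> sXY rX; apply/eqP; rewrite eqn_leq (rk_mono M (subsetUr _ _)) andbT.
have := rk_submod M (x |: X) Y; rewrite -setUA (setUidPr sXY) rX.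
have : M X <= M ((x |: X) :&: Y) by apply: rk_mono; rewrite subsetI subsetUr.
lia.
Qed.

Lemma cl_mono X Y : X \subset Y -> cl M X \subset cl M Y.
Proof.
move=> sXY; apply/subsetP=> x; rewrite !inE => /eqP rX.
by apply/eqP; apply: rk_setU1_eq rX.
Qed.

(** Induction on the size of [Y]: each further element of the closure leaves the rank unchanged. *)
Lemma rk_setU_sub_cl X Y : Y \subset cl M X -> M (X :|: Y) = M X.
Proof.
have [n] := ubnP #|Y|; elim: n Y => // n IHn Y leYn sYX.
have [->|[y yY]] := set_0Vmem Y; first by rewrite setU0.
rewrite -(setD1K yY) setUCA (@rk_setU1_eq X _ y) ?subsetUl //.
  apply: IHn; last exact: subset_trans (subsetDl _ _) sYX.
  by move: leYn; rewrite (cardsD1 y) yY.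
by apply/eqP; move/subsetP/(_ y yY): sYX; rewrite inE.
Qed.

Lemma rk_sub_cl X Y : X \subset Y -> Y \subset cl M X -> M Y = M X.
Proof. by move=> sXY /rk_setU_sub_cl; rewrite (setUidPr sXY). Qed.

Lemma rk_cl X : M (cl M X) = M X.
Proof. exact: rk_sub_cl (sub_cl X) (subxx _). Qed.

Lemma flat_cl X : flat M (cl M X).
Proof.
rewrite /flat eqEsubset sub_cl andbT; apply/subsetP=> x.
rewrite !inE rk_cl => /eqP rx.
rewrite eqn_leq (rk_mono M (subsetUr _ _)) andbT -rx.
exact: rk_mono (setUS _ (sub_cl X)).
Qed.

Lemma flat_bigcap (I : finType) (P : pred I) (F : I -> {set E}) :
  (forall i, P i -> flat M (F i)) -> flat M (\bigcap_(i | P i) F i).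
Proof.
move=> flF; rewrite /flat eqEsubset sub_cl andbT.
apply/bigcapsP=> i Pi; rewrite -(eqP (flF i Pi)).
exact/cl_mono/bigcap_inf.
Qed.

End Closure.

Section PrincipalPartition.
Variables (E : finType) (M : matroid E).
Implicit Types (D B X Y : {set E}) (e : E) (k : nat).

Lemma rk_leS_setD1 X e : M X <= (M (X :\ e)).+1.
Proof.
have := rk_submod M [set e] (X :\ e).
have : M X <= M ([set e] :|: X :\ e).
  by apply: rk_mono; apply/subsetP=> x xX; rewrite !inE xX andbT orbN.
have := rk_le_card M [set e]; rewrite cards1; lia.
Qed.

(** Monotonicity of the nullity $|X| - r(X)$, written additively; submodularity for [X] and
    [Y :\: X] gives $r(Y) \le r(X) + |Y \setminus X|$. *)
Lemma nullity_mono X Y : X \subset Y -> #|X| + M Y <= #|Y| + M X.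
Proof.
move=> sXY; have := rk_submod M X (Y :\: X).
have -> : X :|: Y :\: X = Y by rewrite setDE setUIr setUCr setIT (setUidPr sXY).
have := rk_le_card M (Y :\: X); rewrite cardsDS //.
have := subset_leq_card sXY; lia.
Qed.

(* A minimal subset of [X] with the nullity of [X] is cyclic. *)
Lemma ex_fold_circuit k X :
  M X + k = #|X| -> exists2 B : {set E}, B \subset X & fold_circuit M k B.
Proof.
have [n] := ubnP #|X|; elim: n X => // n IHn X leXn rX.
have [cX|/forall_inPn[e eX ne]] := boolP (cyclic_set M X).
  by exists X => //; rewrite /fold_circuit cX rX eqxx.
have cXe := cardsD1 e X; rewrite eX in cXe.
(* Deleting [e] lowers the rank by exactly one, so the nullity stays [k]. *)
have lt1 := rk_leS_setD1 X e; have le1 := rk_mono M (subsetDl X [set e]).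
have [||B sB fB] := IHn (X :\ e); [lia | by move/eqP: ne; lia |].
by exists B => //; apply: subset_trans sB (subsetDl _ _).
Qed.

(** Since [D] is cyclic, [D :\ e] has nullity $k-1$, so [B1 :|: B2] has nullity at most $k-1$. If
    [f] were in [B2] but not in [B1], deleting it from the union would keep the rank, as [B2] is
    cyclic, and so push the nullity below $k-1$, although [B1], of nullity $k-1$, is still contained
    in the result. *)
Lemma fold_circuit_avoiding_sub k D B1 B2 e :
  fold_circuit M k D -> 0 < k -> e \in D ->
  B1 \subset D :\ e -> fold_circuit M k.-1 B1 ->
  B2 \subset D :\ e -> fold_circuit M k.-1 B2 -> B2 \subset B1.
Proof.
move=> /andP[/forall_inP cD /eqP rD] k_gt0 eD s1 /andP[_ /eqP r1] s2.
case/andP=> /forall_inP c2 _.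
apply/subsetP=> f fB2; apply/contraT=> fB1.
have null_le : #|B1 :|: B2| + M (D :\ e) <= #|D :\ e| + M (B1 :|: B2).
  by apply: nullity_mono; rewrite subUset s1.
rewrite (eqP (cD _ eD)) in null_le.
have cDe := cardsD1 e D; rewrite eD in cDe.
have cUf := cardsD1 f (B1 :|: B2); rewrite inE fB2 orbT in cUf.
have null_ge : #|B1| + M ((B1 :|: B2) :\ f) <= #|(B1 :|: B2) :\ f| + M B1.
  by apply: nullity_mono; rewrite subsetD1 subsetUl.
have rU : M (B1 :|: B2) = M ((B1 :|: B2) :\ f).
  rewrite -{1}(@setD1K _ f (B1 :|: B2)) ?inE ?fB2 ?orbT //.
  apply: (@rk_setU1_eq _ _ (B2 :\ f)); first exact: setSD (subsetUr _ _).
  by rewrite setD1K // (eqP (c2 _ fB2)).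
lia.
Qed.

(** Blocks sharing an element [e] are complements of $(k-1)$-fold circuits that both avoid [e];
    these contain each other, hence coincide. *)
Lemma principal_partition_disjoint k D A1 A2 :
  fold_circuit M k D -> 0 < k ->
  A1 \in principal_partition M k D -> A2 \in principal_partition M k D ->
  A1 != A2 -> [disjoint A1 & A2].
Proof.
move=> fD k0 /imsetP[B1]; rewrite inE => /andP[s1 f1] -> /imsetP[B2].
rewrite inE => /andP[s2 f2] -> ne; rewrite -setI_eq0; apply: contraNT ne.
case/set0Pn=> e; rewrite !inE => /andP[/andP[e1 eD] /andP[e2 _]].
have s1e : B1 \subset D :\ e by rewrite subsetD1 s1.
have s2e : B2 \subset D :\ e by rewrite subsetD1 s2.
have -> // : B1 = B2; apply/eqP; rewrite eqEsubset.
rewrite (fold_circuit_avoiding_sub fD k0 eD s2e f2 s1e f1).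
exact: fold_circuit_avoiding_sub fD k0 eD s1e f1 s2e f2.
Qed.

(** For [e] in [D], the set [D :\ e] has nullity $k-1$ and so contains a $(k-1)$-fold circuit, whose
    complement in [D] is a block containing [e]. *)
Lemma cover_principal_partition k D :
  fold_circuit M k D -> 0 < k -> cover (principal_partition M k D) = D.
Proof.
move=> /andP[/forall_inP cD /eqP rD] k0; apply/eqP; rewrite eqEsubset.
apply/andP; split.
  by apply/bigcupsP=> _ /imsetP[B _ ->]; apply: subsetDl.
apply/subsetP=> e eD; have cDe := cardsD1 e D; rewrite eD in cDe.
have [|B sB fB] := @ex_fold_circuit k.-1 (D :\ e).
  by rewrite (eqP (cD _ eD)); lia.
move: sB; rewrite subsetD1 => /andP[sB eB].
apply/bigcupP; exists (D :\: B); last by rewrite inE eB.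
by apply/imsetP; exists B; rewrite ?inE ?sB.
Qed.

Lemma rk_setD_principal_partition k D A :
  fold_circuit M k D -> 0 < k -> A \in principal_partition M k D ->
  M (D :\: A) + #|A| = (M D).+1.
Proof.
move=> /andP[_ /eqP rD] k0 /imsetP[B]; rewrite inE => /andP[sB /andP[_ /eqP rB]] ->.
rewrite setDDr setDv set0U (setIidPr sB) cardsDS //.
have := subset_leq_card sB; lia.
Qed.

End PrincipalPartition.

(** Telescoping: the total increase reaches its maximum only if every single step does. It serves
    below with [c] the rank of [D]. *)
Lemma unit_step_bound (s : nat -> nat) (c l : nat) :
  s 1 = c.+1 -> (forall n, 0 < n < l.+1 -> s n.+1 <= (s n).+1) ->
  s l.+1 <= c + l.+1 /\
  (s l.+1 = c + l.+1 <-> forall n, 0 < n < l.+1 -> s n.+1 = (s n).+1).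
Proof.
move=> s1; elim: l => [|l IHl] sS.
  by split; [lia | split=> [_ n|]; lia].
have [n|le_s eq_s] := IHl; first by move=> lt_n; apply: sS; lia.
have := sS l.+1; rewrite ltnSn => /(_ isT) leS; split; first lia.
split=> [eqS n lt_n | eqS].
  have [->|ne] := eqVneq n l.+1; first lia.
  by apply: (eq_s.1 _ n); lia.
have := eqS l.+1; rewrite ltnSn => /(_ isT).
have : s l.+1 = c + l.+1 by apply/eq_s => n lt_n; apply: eqS; lia.
lia.
Qed.

Lemma big_ord_ltS (R : Type) (idx : R) (op : Monoid.com_law idx) l (n : 'I_l)
    (F : 'I_l -> R) :
  \big[op/idx]_(i < l | i < n.+1) F i =
  op (\big[op/idx]_(i < l | i < n) F i) (F n).
Proof.
rewrite (bigD1 n) //= Monoid.mulmC; congr (op _ _); apply: eq_bigl => i.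
by rewrite ltnS ltn_neqAle andbC.
Qed.

Lemma big_ord_lt_all (R : Type) (idx : R) (op : R -> R -> R) l (F : 'I_l -> R) :
  \big[op/idx]_(i < l | i < l) F i = \big[op/idx]_(i < l) F i.
Proof. by apply: eq_bigl => i; rewrite ltn_ord. Qed.

Theorem mainTheorem2 (E : finType) (M : matroid E) (k : nat) (D : {set E})
    (l : nat) (A : 'I_l -> {set E})
    (k_gt0 : 0 < k)
    (D_fold : fold_circuit M k D)
    (A_inj : injective A)
    (A_partition : [set A i | i : 'I_l] = principal_partition M k D) :
  ((M (\bigcap_(i < l) cl M (D :\: A i)))%:Z <= l%:Z - k%:Z)%R /\
  (((M (\bigcap_(i < l) cl M (D :\: A i)))%:Z = l%:Z - k%:Z)%R <->
   forall n : 'I_l, 0 < n ->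
     modular_pair M (\bigcap_(i < l | i < n) cl M (D :\: A i))
                    (cl M (D :\: A n))).
Proof.
have A_pp i : A i \in principal_partition M k D.
  by rewrite -A_partition imset_f.
have A_disj i j : i != j -> [disjoint A i & A j].
  by move=> ne; apply: principal_partition_disjoint D_fold k_gt0 _ _ _;
     rewrite ?(inj_eq A_inj).
have D_cover : D = \bigcup_i A i.
  by rewrite -(cover_principal_partition D_fold k_gt0) -A_partition cover_imset.
have card_D : #|D| = \sum_i #|A i|.
  rewrite -(cover_principal_partition D_fold k_gt0) -A_partition.
  rewrite -(eqP (_ : trivIset _)) ?big_imset //=; first by move=> i j _ _ /A_inj.
  apply/trivIsetP=> _ _ /imsetP[i _ ->] /imsetP[j _ ->] ne.
  by apply: A_disj; apply: contraNneq ne => ->.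
have A_sub i : A i \subset D by rewrite D_cover bigcup_sup.
have rD : M D + k = #|D| by case/andP: D_fold => _ /eqP.
(* Without blocks [D] would be empty, contradicting $r(D) + k = |D|$ with $k > 0$. From here on
   there are [l.+1] blocks. *)
case: l => [|l] in A A_inj A_partition A_pp A_disj D_cover card_D A_sub *.
  by exfalso; move: card_D; rewrite big_ord0; lia.
pose F i := cl M (D :\: A i).
pose X n := \bigcap_(i < l.+1 | i < n) F i.
(* Adding the sizes of the blocks used so far turns the bound $r(X_{n+1}) \le r(X_n) - |A_n| + 1$
   into a step of at most one. *)
pose s n := M (X n) + \sum_(i < l.+1 | i < n) #|A i|.
have rF i : M (F i) + #|A i| = (M D).+1.
  by rewrite rk_cl (rk_setD_principal_partition D_fold k_gt0).
(* [X 0] is the empty intersection, that is, the whole ground set, hence the condition [0 < n]. *)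
have X_sub n : 0 < n -> X n \subset cl M D.
  move=> n0; apply: subset_trans (cl_mono _ (subsetDl D (A ord0))).
  exact: (bigcap_inf ord0).
have F_sub i : F i \subset cl M D by apply: cl_mono; apply: subsetDl.
have D_sub (n : 'I_l.+1) : D \subset X n :|: F n.
  apply/subsetP=> x xD; rewrite inE; have [xA|xA] := boolP (x \in A n).
    apply/orP; left; apply/bigcapP=> i lt_in.
    apply: (subsetP (sub_cl _ _)); rewrite inE xD andbT.
    have ne : n != i by apply: contraTneq lt_in => ->; rewrite ltnn.
    by rewrite (disjointFr (A_disj _ _ ne)).
  by apply/orP; right; apply: (subsetP (sub_cl _ _)); rewrite inE xA.
have rXF (n : 'I_l.+1) : 0 < n -> M (X n :|: F n) = M D.
  by move=> n0; apply: rk_sub_cl; rewrite ?D_sub // subUset X_sub ?F_sub.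
have XS (n : 'I_l.+1) : X n.+1 = X n :&: F n by rewrite /X big_ord_ltS.
(* The truncated subtraction is exact: [s n - M (X n)] is the sum of the sizes of the first [n]
   blocks. *)
have sS (n : 'I_l.+1) : s n.+1 = M (X n :&: F n) + #|A n| + (s n - M (X n)).
  rewrite /s XS big_ord_ltS /=; lia.
(* Substituting $r(X_n \cup F_n) = r(D)$ and $r(F_n) = r(D) + 1 - |A_n|$ into the modular equation
   leaves $r(X_n) + 1 = r(X_n \cap F_n) + |A_n|$. *)
have modE (n : 'I_l.+1) : 0 < n ->
    modular_pair M (X n) (F n) = (s n.+1 == (s n).+1).
  move=> n0; rewrite /modular_pair flat_cl flat_bigcap => [|i _]; last exact: flat_cl.
  rewrite rk_cl rXF // sS /=; have := rF n; rewrite /s; lia.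
have s1 : s 1 = (M D).+1.
  by rewrite /s (XS ord0) (@big_ord_ltS _ _ _ _ ord0) /X !big_pred0 // setTI rF.
have s_step n : 0 < n < l.+1 -> s n.+1 <= (s n).+1.
  case/andP=> n0 lt_n; rewrite (sS (Ordinal lt_n)) /=.
  have := rk_submod M (X n) (F (Ordinal lt_n)).
  rewrite (rXF (Ordinal lt_n)) //; have := rF (Ordinal lt_n); rewrite /s; lia.
have [le_s eq_s] := @unit_step_bound s (M D) l s1 s_step.
(* As $|D| = r(D) + k$, the bound $r + |D| \le r(D) + l + 1$ becomes $r \le (l + 1) - k$. *)
set r := M (\bigcap_(i < _) cl M _); have sl : s l.+1 = r + #|D|.
  by rewrite /s /X !big_ord_lt_all card_D.
rewrite sl in le_s eq_s; split; first lia.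
split=> [eq_r n n0 | mod_n].
  rewrite modE //; apply/eqP; apply: (eq_s.1 _ n); last by rewrite n0 ltn_ord.
  lia.
suff : r + #|D| = M D + l.+1 by lia.
apply/eq_s=> n /andP[n0 lt_n]; apply/eqP.
by have := mod_n (Ordinal lt_n) n0; rewrite modE.
Qed.
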